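(* Let $n \geq 3$. If $H$ is a bi-orderable subgroup of $B_n(D)$ such that $P_n(D) \subset H \subset B_n(D)$, then $H = P_n(D)$. In other words, $P_n(D)$ is a maximal bi-orderable subgroup of $B_n(D)$; equivalently, every subgroup $H$ with $P_n(D) \subsetneq H \subset B_n(D)$ is not bi-orderable.
   Context: $D$ denotes the closed disk. $B_n(D)$ is the Artin braid group on $n$ strands, i.e. the group with generators $\sigma_1,\dots,\sigma_{n-1}$ and relations $\sigma_i\sigma_j=\sigma_j\sigma_i$ for $|i-j|\ge 2$ and $\sigma_i\sigma_{i+1}\sigma_i=\sigma_{i+1}\sigma_i\sigma_{i+1}$ for $1\le i\le n-2$. The permutation homomorphism $\pi: B_n(D)\to S_n$ is determined by $\pi(\sigma_i)=(i,i+1)$, and the pure braid group is $P_n(D)=\ker \pi$. A group is bi-orderable if it admits a strict total ordering $<$ such that $x<y$ implies $gx<gy$ and $xg<yg$ for all $x,y,g$. *)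

(* Defs.v *)
(* The braid group B_n(D) is given by its presentation:
   elements are words in the letters sigma_i^{+-1}, modulo the congruence
   generated by free cancellation and the Artin relations. *)
From mathcomp Require Import all_boot all_fingroup.
Set Implicit Arguments. Unset Strict Implicit. Unset Printing Implicit Defensive.

(* A letter (i, b) : 'I_n.-1 * bool stands for sigma_{i+1} if b = false
   and sigma_{i+1}^{-1} if b = true. *)
Definition letter (n : nat) := ('I_n.-1 * bool)%type.
Definition word (n : nat) := seq (letter n).

Definition wone (n : nat) : word n := [::].
Definition wmul (n : nat) (u v : word n) : word n := u ++ v.
Definition winv (n : nat) (u : word n) : word n :=
  rev (map (fun l : letter n => (l.1, ~~ l.2)) u).

Inductive braid_rel (n : nat) : word n -> word n -> Prop :=
| br_cancel (i : 'I_n.-1) (b : bool) :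
    braid_rel [:: (i, b); (i, ~~ b)] [::]
| br_comm (i j : 'I_n.-1) :
    2 <= (if i <= j then j - i else i - j) ->
    braid_rel [:: (i, false); (j, false)] [:: (j, false); (i, false)]
| br_braid (i j : 'I_n.-1) :
    j = i.+1 :> nat ->
    braid_rel [:: (i, false); (j, false); (i, false)]
              [:: (j, false); (i, false); (j, false)].

Inductive beq (n : nat) : word n -> word n -> Prop :=
| beq_refl u : beq u u
| beq_sym u v : beq u v -> beq v u
| beq_trans u v w : beq u v -> beq v w -> beq u w
| beq_ctx a b u v : braid_rel u v -> beq (a ++ u ++ b) (a ++ v ++ b).

Lemma ltn_letter (n : nat) (i : 'I_n.-1) : i < n.
Proof. by case: n i => [|n] [i /= Hi] //; rewrite ltnS ltnW. Qed.
Lemma ltn_letterS (n : nat) (i : 'I_n.-1) : i.+1 < n.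
Proof. by case: n i => [|n] [i /= Hi]. Qed.

Definition sigma_perm (n : nat) (i : 'I_n.-1) : 'S_n :=
  tperm (Ordinal (ltn_letter i)) (Ordinal (ltn_letterS i)).

Definition perm_of_word (n : nat) (w : word n) : 'S_n :=
  foldr (fun (l : letter n) (p : 'S_n) => (sigma_perm l.1 * p)%g) 1%g w.

Definition pure (n : nat) (w : word n) : Prop := perm_of_word w = 1%g.

Definition is_subgroup (n : nat) (H : word n -> Prop) : Prop :=
  [/\ (forall u v, beq u v -> H u -> H v),
      H (wone n),
      (forall u v, H u -> H v -> H (wmul u v)) &
      (forall u, H u -> H (winv u))].

Definition bi_orderable (n : nat) (H : word n -> Prop) : Prop :=
  exists lt : word n -> word n -> Prop,
    [/\ (forall x x' y y', beq x x' -> beq y y' -> lt x y -> lt x' y'),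
        (forall x, H x -> ~ lt x x),
        (forall x y z, H x -> H y -> H z -> lt x y -> lt y z -> lt x z),
        (forall x y, H x -> H y -> [\/ lt x y, beq x y | lt y x]) &
        (forall x y g, H x -> H y -> H g -> lt x y ->
           lt (wmul g x) (wmul g y) /\ lt (wmul x g) (wmul y g))].

(* Main.v *)
(** In a bi-ordered group, if x^k commutes with g for some k > 0 then x commutes
    with g.  Let H contain P_n and a braid w whose permutation p is not trivial.
    Up to conjugation, and up to a factor on far away strands, H contains one of

    - delta = sigma_1 ... sigma_(m-1), if p has a cycle of length m >= 3;
    - sigma_1 sigma_2 sigma_1, if p is an involution with a fixed point;
    - sigma_2 sigma_1 sigma_3 sigma_2, if p has two disjoint 2-cycles.

    In each case a power of this braid x commutes with sigma_1, whereas x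
    conjugates sigma_1^2 to sigma_j^2 with j <> 1.  Since sigma_1^2 and
    sigma_j^2 are distinct, x does not commute with the pure braid sigma_1^2. *)
From Stdlib Require Import Setoid Morphisms.
From mathcomp Require Import all_boot all_fingroup zify.
Require Import Defs.
Set Implicit Arguments. Unset Strict Implicit. Unset Printing Implicit Defensive.

(** * Calculus in the braid group, and commutation in bi-ordered groups *)

Section Congruence.
Variable n : nat.
Implicit Types u v w x y : word n.

#[local] Instance beq_equivalence : Equivalence (@beq n).
Proof.
split=> [u|u v|u v w]; [exact: beq_refl | exact: beq_sym | exact: beq_trans].
Qed.

#[local] Hint Resolve beq_refl : core.

Lemma beq_cat2 a b u v : beq u v -> beq (a ++ u ++ b) (a ++ v ++ b).
Proof.
elim=> [{}u|{}u {}v _|{}u {}v w _ IHuv _|a' b' {}u {}v uv].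
- exact: beq_refl.
- exact: beq_sym.
- exact: beq_trans.
- by rewrite -!catA !(catA a a'); apply: beq_ctx.
Qed.

#[local] Instance cat_beq : Proper (@beq n ==> @beq n ==> @beq n) cat.
Proof.
move=> u u' uu' v v' vv'; transitivity (u ++ v').
  by have := beq_cat2 u [::] vv'; rewrite !cats0.
by have := beq_cat2 [::] v' uu'.
Qed.

Lemma winv_cons l u : winv (l :: u) = winv u ++ [:: (l.1, ~~ l.2)].
Proof. by rewrite /winv /= rev_cons -cats1. Qed.

Lemma beq_mulV u : beq (u ++ winv u) [::].
Proof.
elim: u => [|[i b] u IHu]; first exact: beq_refl.
rewrite winv_cons -cat1s -catA (catA u) IHu /=.
by have := beq_ctx [::] [::] (br_cancel i b).
Qed.

Lemma beq_mulVl u : beq (winv u ++ u) [::].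
Proof.
elim: u => [|[i b] u IHu]; first exact: beq_refl.
rewrite winv_cons -catA /=.
have E : beq [:: (i, ~~ b); (i, b)] [::].
  by have := beq_ctx [::] [::] (br_cancel i (~~ b)); rewrite negbK.
by have -> := cat_beq (beq_refl (winv u)) (cat_beq E (beq_refl u)).
Qed.

Lemma beq_mulIr w u v : beq (u ++ w) (v ++ w) -> beq u v.
Proof.
move=> uv; have := cat_beq uv (beq_refl (winv w)).
by rewrite -!catA beq_mulV !cats0.
Qed.

Lemma beq_mulIl w u v : beq (w ++ u) (w ++ v) -> beq u v.
Proof.
move=> uv; have := cat_beq (beq_refl (winv w)) uv.
by rewrite !catA beq_mulVl.
Qed.

Fixpoint wpow x k : word n := if k is k'.+1 then x ++ wpow x k' else [::].

Lemma wpowD x j k : wpow x (j + k) = wpow x j ++ wpow x k.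
Proof. by elim: j => //= j ->; rewrite catA. Qed.

(** Conjugation of [u] to [v] by [x], written without inverses so that it composes under
    concatenation; for [u = v] it is commutation. *)
Definition intertwines x u v := beq (x ++ u) (v ++ x).

Lemma intertwines_catl x y u v w :
  intertwines x v w -> intertwines y u v -> intertwines (x ++ y) u w.
Proof.
by rewrite /intertwines -catA => xvw ->; rewrite catA xvw -catA.
Qed.

Lemma intertwines_catr x u v u' v' :
  intertwines x u v -> intertwines x u' v' -> intertwines x (u ++ u') (v ++ v').
Proof.
by rewrite /intertwines catA => -> xuv; rewrite -catA xuv catA.
Qed.

Lemma intertwines_wpow x u k : intertwines x u u -> intertwines (wpow x k) u u.
Proof.
move=> xu; elim: k => [|k IHk]; first by rewrite /intertwines cats0.
exact: intertwines_catl IHk.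
Qed.

Lemma wpow_cat x y k :
  intertwines y x x -> beq (wpow (x ++ y) k) (wpow x k ++ wpow y k).
Proof.
move=> xy; elim: k => [|k IHk] /=; first exact: beq_refl.
rewrite IHk -!catA (catA y).
suff -> : beq (y ++ wpow x k) (wpow x k ++ y) by rewrite -catA.
by apply: beq_sym; apply: intertwines_wpow; apply: beq_sym.
Qed.

Lemma wpow_conj c x k :
  beq (wpow (c ++ x ++ winv c) k) (c ++ wpow x k ++ winv c).
Proof.
elim: k => [|k IHk] /=; first by rewrite beq_mulV.
by rewrite IHk -!catA (catA (winv c)) beq_mulVl.
Qed.

Lemma perm_of_word_cat u v :
  perm_of_word (u ++ v) = (perm_of_word u * perm_of_word v)%g.
Proof. by elim: u => [|l u IHu] /=; rewrite ?mul1g // IHu mulgA. Qed.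

Lemma perm_of_word_inv u : perm_of_word (winv u) = (perm_of_word u)^-1%g.
Proof.
elim: u => [|l u IHu] /=; first by rewrite invg1.
by rewrite winv_cons perm_of_word_cat IHu invMg /= mulg1 tpermV.
Qed.

(* In a bi-ordered group x g < g x would give x^k g < g x^k for all k > 0. *)
Lemma bi_orderable_commute (H : word n -> Prop) x g k :
  is_subgroup H -> bi_orderable H -> H x -> H g ->
  intertwines (wpow x k.+1) g g -> intertwines x g g.
Proof.
move=> [HE H1 HM HV] [lt [ltE ltI ltT lt3 ltM]] Hx Hg xkg.
have Hxk j : H (wpow x j) by elim: j => [|j IHj] //=; apply: HM.
case: (lt3 _ _ (HM _ _ Hx Hg) (HM _ _ Hg Hx)) => // xg; exfalso.
- suff : lt (wpow x k.+1 ++ g) (g ++ wpow x k.+1).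
    move=> /(ltE _ _ _ _ xkg (beq_refl _)); apply: ltI; exact: HM.
  elim: (k) => [|j IHj]; first by rewrite /= cats0.
  rewrite [wpow _ j.+2]/= -/(wpow x j.+1).
  (* Multiplying the induction hypothesis by [x] on the left leads up to this middle term;
     multiplying [x g < g x] by [x^(j+1)] on the right leads on from it. *)
  apply: (ltT _ (wmul (wmul x g) (wpow x j.+1))).
  + exact: HM (HM _ _ Hx (Hxk _)) Hg.
  + exact: HM (HM _ _ Hx Hg) (Hxk _).
  + exact: HM Hg (HM _ _ Hx (Hxk _)).
  + by have [] := ltM _ _ _ (HM _ _ (Hxk _) Hg) (HM _ _ Hg (Hxk _)) Hx IHj;
      rewrite /wmul !catA.
  + by have [] := ltM _ _ _ (HM _ _ Hx Hg) (HM _ _ Hg Hx) (Hxk j.+1) xg;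
      rewrite /wmul !catA.
- suff : lt (g ++ wpow x k.+1) (wpow x k.+1 ++ g).
    move=> /(ltE _ _ _ _ (beq_refl _) xkg); apply: ltI; exact: HM.
  elim: (k) => [|j IHj]; first by rewrite /= cats0.
  rewrite [wpow _ j.+2]/= -/(wpow x j.+1).
  apply: (ltT _ (wmul (wmul x g) (wpow x j.+1))).
  + exact: HM Hg (HM _ _ Hx (Hxk _)).
  + exact: HM (HM _ _ Hx Hg) (Hxk _).
  + exact: HM (HM _ _ Hx (Hxk _)) Hg.
  + by have [] := ltM _ _ _ (HM _ _ Hg Hx) (HM _ _ Hx Hg) (Hxk j.+1) xg;
      rewrite /wmul !catA.
  + by have [] := ltM _ _ _ (HM _ _ Hg (Hxk _)) (HM _ _ (Hxk _) Hg) Hx IHj;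
      rewrite /wmul !catA.
Qed.

(** The product of [v] and the inverse of [u] is pure, so membership in [H] depends only on the
    permutation. *)
Lemma mem_subgroup_perm (H : word n -> Prop) u v :
  is_subgroup H -> (forall w, pure w -> H w) ->
  perm_of_word u = perm_of_word v -> H u -> H v.
Proof.
move=> [HE _ HM _] HP uv Hu.
have /HM/(_ Hu) : H (v ++ winv u).
  by apply: HP; rewrite /pure perm_of_word_cat perm_of_word_inv uv mulgV.
by apply: HE; rewrite /wmul -catA beq_mulVl cats0.
Qed.

End Congruence.

#[local] Existing Instance beq_equivalence.
#[local] Existing Instance cat_beq.
#[local] Hint Resolve beq_refl : core.

(** * A signed permutation action of the braid group *)

(* The Tong-Yang-Ma representation sigma_i |-> [[0, 1], [t, 0]] at t = -1,
   written as an action on signed points (position, sign). *)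
Definition signed_swap (i : nat) (b : bool) (z : nat * bool) : nat * bool :=
  if z.1 == i then (i.+1, z.2 (+) b)
  else if z.1 == i.+1 then (i, z.2 (+) ~~ b) else z.

Definition signed_action n (w : word n) (z : nat * bool) : nat * bool :=
  foldl (fun z (l : letter n) => signed_swap l.1 l.2 z) z w.

Lemma signed_swapL i b s : signed_swap i b (i, s) = (i.+1, s (+) b).
Proof. by rewrite /signed_swap eqxx. Qed.

Lemma signed_swapR i b s : signed_swap i b (i.+1, s) = (i, s (+) ~~ b).
Proof. by rewrite /signed_swap /= eqxx; case: eqP => //; lia. Qed.

Lemma signed_swap_out i b x s : (x != i) && (x != i.+1) ->
  signed_swap i b (x, s) = (x, s).
Proof. by rewrite /signed_swap /= => /andP[/negPf-> /negPf->]. Qed.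

Lemma signed_swapK i b z : signed_swap i (~~ b) (signed_swap i b z) = z.
Proof.
case: z => x s; have [->|xi] := eqVneq x i.
  by rewrite signed_swapL signed_swapR negbK -addbA addbb addbF.
have [->|xi1] := eqVneq x i.+1.
  by rewrite signed_swapR signed_swapL -addbA addbb addbF.
by rewrite !signed_swap_out ?xi.
Qed.

Lemma signed_swap_comm i j b z : (i.+1 < j) || (j.+1 < i) ->
  signed_swap j b (signed_swap i b z) = signed_swap i b (signed_swap j b z).
Proof.
case: z => x s ij.
have [->|xi] := eqVneq x i.
  by rewrite signed_swapL !(@signed_swap_out j) ?signed_swapL //; lia.
have [->|xi1] := eqVneq x i.+1.
  by rewrite signed_swapR !(@signed_swap_out j) ?signed_swapR //; lia.
rewrite (@signed_swap_out i _ x) ?xi //.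
have [->|xj] := eqVneq x j.
  by rewrite signed_swapL signed_swap_out //; lia.
have [->|xj1] := eqVneq x j.+1.
  by rewrite signed_swapR signed_swap_out //; lia.
by rewrite !signed_swap_out ?xi ?xj.
Qed.

Lemma signed_swap_braid i z (t := fun j => signed_swap j false) :
  t i (t i.+1 (t i z)) = t i.+1 (t i (t i.+1 z)).
Proof.
case: z => x s; rewrite {}/t.
have [->|xi] := eqVneq x i.
  rewrite !signed_swapL (@signed_swap_out i.+1 _ i) ?signed_swapL; last by lia.
  by rewrite signed_swap_out ?signed_swapL //; lia.
have [->|xi1] := eqVneq x i.+1.
  rewrite signed_swapR signed_swapL (@signed_swap_out i.+1 _ i); last by lia.
  rewrite (@signed_swap_out i _ i.+2); last by lia.
  by rewrite signed_swapL signed_swapR !addbF.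
have [->|xi2] := eqVneq x i.+2.
  rewrite !signed_swapR (@signed_swap_out i _ i.+2) ?signed_swapR; last by lia.
  by rewrite signed_swap_out ?signed_swapR //; lia.
by rewrite !signed_swap_out //; lia.
Qed.

Lemma signed_action_beq n (u v : word n) :
  beq u v -> signed_action u =1 signed_action v.
Proof.
elim=> {u v} [//|u v _ IH z|u v w _ IHu _ IHv z|a b u v uv z].
- by rewrite IH.
- by rewrite IHu.
- rewrite /signed_action !foldl_cat; congr foldl.
  case: uv (foldl _ z a) => {u v a b z} [i b|i j ij|i j ij] z /=.
  + exact: signed_swapK.
  + by apply: signed_swap_comm; move: ij; case: ifP; lia.
  + by rewrite ij signed_swap_braid.
Qed.

(** Both braids are pure, so only signs can separate them: the first flips the sign at position [i],
    where the second acts trivially since [i < j]. *)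
Lemma sigma_sqr_neq n (i j : 'I_n.-1) :
  i < j -> ~ beq [:: (i, false); (i, false)] [:: (j, false); (j, false)].
Proof.
move=> ij /signed_action_beq/(_ (nat_of_ord i, false)).
rewrite /signed_action /signed_swap /=.
by repeat (case: eqP => /=; try lia).
Qed.

(** Appending the missing points to [l] enumerates ['I_n]. This serves to relabel chosen points as
    the first positions. *)
Lemma perm_extend n (l : seq 'I_n) : uniq l ->
  exists s : 'S_n, forall (x : 'I_n), x < size l -> s x = nth x l x.
Proof.
move=> Ul; pose L := l ++ filter [predC l] (enum 'I_n).
have PL : perm_eq L (enum 'I_n).
  apply: uniq_perm; first 1 last; rewrite ?enum_uniq //.
    by move=> x; rewrite mem_cat mem_filter mem_enum /= andbT orbN.
  rewrite cat_uniq Ul filter_uniq ?enum_uniq // andbT /=.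
  by apply/hasPn => x; rewrite mem_filter => /andP[].
have szL : size L = n by rewrite (perm_size PL) size_enum_ord.
have UL : uniq L by rewrite (perm_uniq PL) enum_uniq.
have inj : injective (fun x : 'I_n => nth x L x).
  move=> x y /=; rewrite (set_nth_default x y) ?szL // => /eqP.
  by rewrite nth_uniq ?szL // => /eqP/val_inj.
by exists (perm inj) => x xl; rewrite permE nth_cat xl.
Qed.

(** * Positive words, their permutations, and the localized obstruction *)

Section Generators.
Variable n : nat.
Implicit Types (u v w x y : word n.+2) (i j k m : nat).

(* sigma_(i+1); meaningful only for i <= n, since inord is constant beyond. *)
Definition sg i : letter n.+2 := (inord i : 'I_n.+1, false).

Lemma sg_comm i j : i.+1 < j <= n -> intertwines [:: sg i] [:: sg j] [:: sg j].
Proof.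
move=> ij; rewrite /intertwines.
have C : 2 <= (if (inord i : 'I_n.+1) <= (inord j : 'I_n.+1)
    then (inord j : 'I_n.+1) - (inord i : 'I_n.+1)
    else (inord i : 'I_n.+1) - (inord j : 'I_n.+1)).
  by rewrite !inordK; [case: ifP; lia|lia|lia].
by have := beq_ctx [::] [::] (@br_comm n.+2 _ _ C).
Qed.

Lemma sg_braid i : i < n ->
  beq [:: sg i; sg i.+1; sg i] [:: sg i.+1; sg i; sg i.+1].
Proof.
move=> ij; have E : (inord i.+1 : 'I_n.+1) = (inord i : 'I_n.+1).+1 :> nat.
  by rewrite !inordK; lia.
by have := beq_ctx [::] [::] (@br_braid n.+2 _ _ E).
Qed.

Definition swap_nat i j := if j == i then i.+1 else if j == i.+1 then i else j.

Lemma val_sigma_perm i (z : 'I_n.+2) :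
  i <= n -> val (sigma_perm (sg i).1 z) = swap_nat i (val z).
Proof.
move=> le_in; rewrite /sigma_perm /swap_nat.
by case: tpermP => [->|->|/eqP + /eqP]; rewrite -?val_eqE /= ?inordK //;
  repeat (case: eqP => /=); lia.
Qed.

Definition sgs (l : seq nat) : word n.+2 := map sg l.

Lemma sgs_cat l1 l2 : sgs (l1 ++ l2) = sgs l1 ++ sgs l2.
Proof. exact: map_cat. Qed.

Lemma val_perm_sgs l (z : 'I_n.+2) : all (leq^~ n) l ->
  val (perm_of_word (sgs l) z) = foldl (fun j i => swap_nat i j) (val z) l.
Proof.
elim: l z => [|i l IHl] z /=; first by rewrite perm1.
by case/andP=> le_in le_ln; rewrite permM IHl // val_sigma_perm.
Qed.

(** The letters of [l1] involve only positions below [m], those of [l2] only positions from [m] on,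
    so any two indices differ by at least 2. *)
Lemma sgs_comm m (l1 l2 : seq nat) :
  all (fun i => i.+1 < m) l1 -> all (fun i => m <= i <= n) l2 ->
  intertwines (sgs l1) (sgs l2) (sgs l2).
Proof.
move=> l1m l2m; elim: l1 l1m => [_|i l1 IHl1 /= /andP[im l1m]].
  by rewrite /intertwines cats0.
apply: (@intertwines_catl _ [:: sg i]) (IHl1 l1m).
elim: l2 l2m {IHl1} => [_|j l2 IHl2 /= /andP[jm l2m]].
  by rewrite /intertwines cats0.
apply: (@intertwines_catr _ _ [:: sg j] [:: sg j]) (IHl2 l2m).
by apply: sg_comm; lia.
Qed.

(** Bubble sort: the outer induction advances past a fixed position [m], the inner one lowers the
    image of [m] until it is fixed. *)
Lemma sgs_surj m (s : 'S_n.+2) : (forall z : 'I_n.+2, z < m -> s z = z) ->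
  exists2 l, all (fun i => m <= i <= n) l & perm_of_word (sgs l) = s.
Proof.
have [d] := ubnP (n.+2 - m); elim: d => // d IHd in m s *.
rewrite ltnS => dm sm.
have [le_nm|lt_mn] := leqP n.+2 m.
  exists [::] => //; apply/permP=> z; rewrite perm1 sm //.
  exact: leq_trans (ltn_ord z) le_nm.
pose z0 : 'I_n.+2 := Ordinal lt_mn.
have [e] := ubnP (val (s z0)); elim: e => // e IHe in s sm *.
rewrite ltnS => se.
have s_ge (z : 'I_n.+2) : m <= z -> m <= s z.
  move=> mz; rewrite leqNgt; apply/negP=> /[dup] szm /sm/perm_inj sz.
  by rewrite sz ltnNge mz in szm.
have [s0|s0] := eqVneq (s z0) z0.
  have [||l lm ls] := IHd m.+1 s; first by lia.
    move=> z; rewrite ltnS leq_eqVlt => /orP[/eqP zm|/sm //].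
    by rewrite (_ : z = z0) //; apply: val_inj.
  by exists l => //; apply: sub_all lm => i; lia.
have mk : m <= val (s z0) := s_ge z0 (leqnn _).
have {}s0 : val (s z0) != m by rewrite -val_eqE in s0.
have ltk : val (s z0) < n.+2 := ltn_ord (s z0).
have [k ks] : {k | k = val (s z0)} by exists (val (s z0)).
rewrite -ks in se mk s0 ltk.
have kn : k.-1 <= n by lia.
(* Since [k > m], exchanging the values [k-1] and [k] lowers the image of [z0] by one and keeps
   every point below [m] fixed. *)
have [||l lm ls] := IHe (s * sigma_perm (sg k.-1).1)%g.
- move=> z zm; apply: val_inj.
  rewrite permM val_sigma_perm // sm // /swap_nat /=.
  by do !case: eqP => ?; lia.
- rewrite permM val_sigma_perm // -ks /swap_nat.
  by do !case: eqP => ?; lia.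
exists (l ++ [:: k.-1]); first by rewrite all_cat lm /=; lia.
by rewrite sgs_cat perm_of_word_cat ls /= mulg1 -mulgA tperm2 mulg1.
Qed.

(* A factor y on the strands >= m completes x0 = sgs l to y x0, a conjugate of
   which has the permutation of w and therefore lies in H. *)
Lemma bi_orderable_no_local_braid (H : word n.+2 -> Prop) w (s : 'S_n.+2)
    m l e f k :
  is_subgroup H -> (forall w, pure w -> H w) -> bi_orderable H -> H w ->
  m <= n.+2 -> all (fun i => i.+1 < m) l -> e < f -> f.+1 < m ->
  (forall z : 'I_n.+2, z < m ->
     perm_of_word w (s z) = s (perm_of_word (sgs l) z)) ->
  intertwines (sgs l) [:: sg e] [:: sg f] ->
  intertwines (wpow (sgs l) k.+1) [:: sg e] [:: sg e] -> False.
Proof.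
move=> sH HP oH Hw mn lm ef fm ws lef lk.
have [lc _ cs] : exists2 l, all (fun i => 0 <= i <= n) l &
    perm_of_word (sgs l) = s^-1%g by apply: sgs_surj.
(* By [ws] this permutation fixes every point below [m]. It is chosen so that [y x0], conjugated by
   [c], gets the permutation of [w]. *)
have [ly lym ys] : exists2 l', all (fun i => m <= i <= n) l' &
    perm_of_word (sgs l') =
      (s * perm_of_word w * s^-1 * (perm_of_word (sgs l))^-1)%g.
  by apply: sgs_surj => z zm; rewrite !permM ws // !permK.
set x0 := sgs l in ws lef lk ys; set y := sgs ly in ys.
set c := sgs lc in cs.
have yx0 : intertwines x0 y y by apply: sgs_comm lm lym.
have ye i : i.+1 < m -> intertwines y [:: sg i] [:: sg i].
  by move=> im; apply: beq_sym; apply: (@sgs_comm m [:: i]) => //=; rewrite im.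
(* The square makes [g] pure, so that its conjugates lie in [H]. *)
pose x := y ++ x0; pose g : word n.+2 := [:: sg e] ++ [:: sg e].
have xg : intertwines (wpow x k.+1) g g.
  rewrite /intertwines !(wpow_cat _ yx0).
  have E : intertwines (wpow y k.+1 ++ wpow x0 k.+1) [:: sg e] [:: sg e].
    by apply: intertwines_catl lk; apply: intertwines_wpow; apply: ye; lia.
  exact: intertwines_catr.
have xgf : intertwines x g ([:: sg f] ++ [:: sg f]).
  have E : intertwines x [:: sg e] [:: sg f].
    by apply: intertwines_catl lef; apply: ye.
  exact: intertwines_catr.
have Hx : H (c ++ x ++ winv c).
  apply: mem_subgroup_perm Hw => //.
  by rewrite !perm_of_word_cat perm_of_word_inv cs ys invgK !mulgA mulgKV
             mulVg mul1g mulgKV.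
have Hg : H (c ++ g ++ winv c).
  apply: HP; rewrite /pure !perm_of_word_cat perm_of_word_inv /= mulg1.
  by rewrite tperm2 mul1g mulgV.
have conjM u v :
    beq ((c ++ u ++ winv c) ++ (c ++ v ++ winv c)) (c ++ (u ++ v) ++ winv c).
  by rewrite -!catA (catA (winv c)) beq_mulVl.
have : intertwines (c ++ x ++ winv c) (c ++ g ++ winv c) (c ++ g ++ winv c).
  apply: (bi_orderable_commute (k := k) sH oH Hx Hg).
  by rewrite /intertwines !wpow_conj !conjM xg.
(* Cancelling [c], its inverse and [x] leaves equality of the squares of [sg e] and [sg f]. *)
rewrite /intertwines !conjM xgf => /beq_mulIl/beq_mulIr/beq_mulIr/beq_sym.
by apply: sigma_sqr_neq; rewrite !inordK; lia.
Qed.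

(** * The local braids and their powers commuting with [sg 0] *)

Lemma foldl_swap_iota a k j :
  foldl (fun j i => swap_nat i j) j (iota a k) =
  if j == a then a + k else if a < j <= a + k then j.-1 else j.
Proof.
elim: k a j => [|k IHk] a j /=; first by do !case: ifP; lia.
by rewrite IHk /swap_nat; do !case: ifP => //; lia.
Qed.

(** Split delta around its letters [i] and [i+1]: these two give a braid relation, and the outer
    blocks commute with the generator passing through them. *)
Lemma delta_shift i k : i.+1 < k <= n.+1 ->
  intertwines (sgs (iota 0 k)) [:: sg i] [:: sg i.+1].
Proof.
move=> ik; have -> : k = i + (2 + (k - i.+2)) by lia.
rewrite !iotaD !sgs_cat add0n.
apply: (@intertwines_catl _ _ _ _ [:: sg i.+1]).
  apply: (@sgs_comm i.+1 _ [:: i.+1]); last by rewrite /=; lia.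
  by apply/allP=> j; rewrite mem_iota; lia.
apply: (@intertwines_catl _ _ _ _ [:: sg i]).
  by apply: sg_braid; lia.
apply: beq_sym; apply: (@sgs_comm i.+2 [:: i]) => /=; first by rewrite ltnSn.
by apply/allP=> j; rewrite mem_iota; lia.
Qed.

(** Let [t] be the last letter of [d = d' t = sg 0 d1]. By [delta_shift], [d d' = d1 d], so
    [d d = d1 d t]; multiplying by [sg 0] on the left gives [sg 0 d d = d d t]. *)
Lemma delta_sqr_last k : 1 < k <= n.+1 ->
  intertwines (sgs (iota 0 k) ++ sgs (iota 0 k)) [:: sg k.-1] [:: sg 0].
Proof.
case: k => // k kn; rewrite /intertwines [_.-1]/=.
have shift j : j <= k ->
    intertwines (sgs (iota 0 k.+1)) (sgs (iota 0 j)) (sgs (iota 1 j)).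
  elim: j => [|j IHj] jk; first by rewrite /intertwines cats0.
  rewrite -(addn1 j) !iotaD !sgs_cat.
  apply: intertwines_catr; first by apply: IHj; lia.
  by apply: delta_shift; lia.
have dE : sgs (iota 0 k.+1) = sgs (iota 0 k) ++ [:: sg k].
  by rewrite -(addn1 k) iotaD sgs_cat.
have {shift} := shift k (leqnn k); rewrite /intertwines.
set d := sgs (iota 0 k.+1) in dE *; set d1 := sgs (iota 1 k) => shift.
have ddE : beq (d ++ d) (d1 ++ d ++ [:: sg k]).
  by rewrite {2}dE catA shift -catA.
transitivity ([:: sg 0] ++ d1 ++ d ++ [:: sg k]); first by rewrite -catA.
by rewrite -ddE.
Qed.

(** After [k-1] shifts [sg 0] becomes [sg k.-1], and two more factors bring it back. This power is
    the full twist on [k+1] strands. *)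
Lemma delta_pow k : 1 < k <= n.+1 ->
  intertwines (wpow (sgs (iota 0 k)) k.+1) [:: sg 0] [:: sg 0].
Proof.
move=> kn; have -> : k.+1 = 2 + k.-1 by lia.
rewrite wpowD; apply: (@intertwines_catl _ _ _ _ [:: sg k.-1]).
  by rewrite /= cats0; apply: delta_sqr_last.
have {kn} : k.-1 < k <= n.+1 by lia.
elim: (k.-1) => [|j IHj] jk; first by rewrite /intertwines cats0.
rewrite /=; apply: (@intertwines_catl _ _ _ _ [:: sg j]).
  exact: delta_shift.
by apply: IHj; lia.
Qed.

Lemma half_twist3_sg0 :
  0 < n -> intertwines (sgs [:: 0; 1; 0]) [:: sg 0] [:: sg 1].
Proof. by move=> n0; exact: (beq_cat2 [::] [:: sg 0] (sg_braid n0)). Qed.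

Lemma half_twist3_sg1 :
  0 < n -> intertwines (sgs [:: 0; 1; 0]) [:: sg 1] [:: sg 0].
Proof.
by move=> n0; exact: (beq_cat2 [:: sg 0] [::] (beq_sym (sg_braid n0))).
Qed.

(** The braid carries two parallel strands across two others, so a crossing inside one pair slides
    to the other pair. *)
Lemma pair_swap_sg0 :
  1 < n -> intertwines (sgs [:: 1; 0; 2; 1]) [:: sg 0] [:: sg 2].
Proof.
move=> n1; have B i (i2 : i < 2) := sg_braid (leq_trans i2 n1).
rewrite /intertwines.
have C : beq [:: sg 0; sg 2] [:: sg 2; sg 0] by apply: sg_comm.
transitivity [:: sg 1; sg 2; sg 0; sg 1; sg 0].
  exact: (beq_cat2 [:: sg 1] [:: sg 1; sg 0] C).
transitivity [:: sg 1; sg 2; sg 1; sg 0; sg 1].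
  exact: (beq_cat2 [:: sg 1; sg 2] [::] (B 0 isT)).
transitivity [:: sg 2; sg 1; sg 2; sg 0; sg 1].
  exact: (beq_cat2 [::] [:: sg 0; sg 1] (B 1 isT)).
exact: (beq_cat2 [:: sg 2; sg 1] [:: sg 1] (beq_sym C)).
Qed.

Lemma pair_swap_sg2 :
  1 < n -> intertwines (sgs [:: 1; 0; 2; 1]) [:: sg 2] [:: sg 0].
Proof.
move=> n1; have B i (i2 : i < 2) := sg_braid (leq_trans i2 n1).
rewrite /intertwines.
transitivity [:: sg 1; sg 0; sg 1; sg 2; sg 1].
  exact: (beq_cat2 [:: sg 1; sg 0] [::] (beq_sym (B 1 isT))).
exact: (beq_cat2 [::] [:: sg 2; sg 1] (beq_sym (B 0 isT))).
Qed.

(** * Excluding the nontrivial cycle types *)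

Lemma bi_orderable_involution (H : word n.+2 -> Prop) w (a : 'I_n.+2) :
  is_subgroup H -> (forall w, pure w -> H w) -> bi_orderable H -> H w ->
  perm_of_word w (perm_of_word w a) = a.
Proof.
move=> sH HP oH Hw; set p := perm_of_word w.
have [//|paa] := eqVneq (p (p a)) a; exfalso.
(* The cycle of [a] is listed along the inverse of [p] because delta moves each position [z > 0] to
   [z-1], and 0 to [m-1]. *)
pose m := #|porbit p^-1 a|.
have iterm : iter m p^-1%g a = a by apply: iter_porbit.
have m2 : 2 < m.
  have : 0 < m by rewrite lt0n card_porbit_neq0.
  case: m iterm => [|[|[|m]]] //= E _.
    by case/eqP: paa; rewrite -{1}E permKV -{1}E permKV.
  by case/eqP: paa; rewrite -{1}E !permKV.
have mn : m <= n.+2 by rewrite -[n.+2]card_ord max_card.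
have Ul : uniq (traject p^-1%g a m) by apply: uniq_traject_porbit.
have [s sl] := perm_extend Ul; rewrite size_traject in sl.
have {}sl (z : 'I_n.+2) : z < m -> s z = iter z p^-1%g a.
  by move=> zm; rewrite sl // (set_nth_default a) ?size_traject // nth_traject.
have dn : all (leq^~ n) (iota 0 m.-1).
  by apply/allP=> j; rewrite mem_iota; lia.
apply: (@bi_orderable_no_local_braid H w s m (iota 0 m.-1) 0 1 m.-1) => //.
- by apply/allP=> j; rewrite mem_iota; lia.
- move=> z zm; rewrite -/p sl //.
  have zE := val_perm_sgs z dn; rewrite foldl_swap_iota /= in zE.
  rewrite sl zE; last by do !case: ifP; lia.
  case: eqP => z0.
    rewrite z0 /=; apply: (@perm_inj _ p^-1%g).
    by rewrite permK -iterS prednK ?iterm //; lia.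
  rewrite ifT; last by lia.
  have {1}-> : nat_of_ord z = z.-1.+1 by lia.
  by rewrite /= permKV.
- by apply: delta_shift; lia.
- by apply: delta_pow; lia.
Qed.

End Generators.

Theorem theorem1 (n : nat) (H : word n -> Prop) :
  3 <= n ->
  is_subgroup H ->
  (forall w : word n, pure w -> H w) ->
  bi_orderable H ->
  forall w : word n, H w -> pure w.
Proof.
case: n H => [|[|[|n]]] // H _ sH HP oH w Hw.
have inv a := bi_orderable_involution a sH HP oH Hw.
apply/eqP/idPn => p1; set p := perm_of_word w in inv p1.
have /existsP[a pa] : [exists a, p a != a].
  apply: contraR p1 => /existsPn pid; apply/eqP/permP=> a.
  by rewrite perm1; apply/eqP; rewrite -[_ == _]negbK.
have [b ba bp] : exists2 b, b != a & b != p a.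
  have : 0 < #|~: [set a; p a]| by rewrite cardsCs setCK card_ord cards2; lia.
  by case/card_gt0P=> b; rewrite !inE negb_or => /andP[]; exists b.
have [pb|pb] := eqVneq (p b) b.
  (* The fixed point goes in the middle: the half twist exchanges positions 0 and 2 and fixes 1. *)
  have Ul : uniq [:: a; b; p a].
    by rewrite /= !inE negb_or eq_sym ba eq_sym pa bp.
  have [s sl] := perm_extend Ul.
  apply: (@bi_orderable_no_local_braid _ H w s 3 [:: 0; 1; 0] 0 1 1) => //.
  - move=> z z3; have zE := @val_perm_sgs n.+1 [:: 0; 1; 0] z isT.
    rewrite (sl z) // sl zE; last by case: z z3 {zE} => [[|[|[|?]]]].
    by case: z z3 {zE} => [[|[|[|?]]]] //= *; rewrite ?inv.
  - exact: half_twist3_sg0.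
  - exact: intertwines_catl (half_twist3_sg1 _) (half_twist3_sg0 _).
(* The order matches the pair swap, which exchanges 0 with 2 and 1 with 3. *)
have Ul : uniq [:: a; b; p a; p b].
  rewrite /= !inE !negb_or (inj_eq perm_inj) !(eq_sym a) ba pa bp.
  rewrite (eq_sym b (p b)) pb !andbT /=.
  by apply: contraNneq bp => <-; rewrite inv.
have n0 : 0 < n.
  have := max_card (mem [:: a; b; p a; p b]).
  by rewrite (card_uniqP Ul) card_ord.
have [s sl] := perm_extend Ul.
have xn : all (leq^~ n.+1) [:: 1; 0; 2; 1] by rewrite /=; lia.
apply: (@bi_orderable_no_local_braid _ H w s 4 [:: 1; 0; 2; 1] 0 2 1) => //.
- move=> z z4; have zE := val_perm_sgs z xn.
  rewrite (sl z) // sl zE; last by case: z z4 {zE} => [[|[|[|[|?]]]]].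
  by case: z z4 {zE} => [[|[|[|[|?]]]]] //= *; rewrite ?inv.
- exact: pair_swap_sg0.
- exact: intertwines_catl (pair_swap_sg2 _) (pair_swap_sg0 _).
Qed.
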